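(* Suppose $f:X\to Y$ is an ls-continuous map between ls-spaces. If $f$ is coarsely light, then the asymptotic dimension of $X$ is at most the asymptotic dimension of $Y$.
   Context: For families $\mathcal{B},\mathcal{U}$ of subsets of a set $X$, $\mathrm{st}(B,\mathcal{U})$ is the union of the elements of $\mathcal{U}$ that intersect $B\subseteq X$, and $\mathrm{st}(\mathcal{B},\mathcal{U})=\{\mathrm{st}(B,\mathcal{U})\mid B\in\mathcal{B}\}$. A large scale structure (ls-structure) on $X$ is a nonempty set $\mathcal{L}$ of families of subsets of $X$ (the uniformly bounded families) such that (1) if $\mathcal{B}_1\in\mathcal{L}$ and each element of $\mathcal{B}_2$ with more than one point is contained in an element of $\mathcal{B}_1$, then $\mathcal{B}_2\in\mathcal{L}$; (2) $\mathcal{B}_1,\mathcal{B}_2\in\mathcal{L}$ implies $\mathrm{st}(\mathcal{B}_1,\mathcal{B}_2)\in\mathcal{L}$. An ls-space is a set with an ls-structure. A map $f:X\to Y$ of ls-spaces is ls-continuous if $f(\mathcal{U})=\{f(U)\mid U\in\mathcal{U}\}$ is uniformly bounded for every uniformly bounded $\mathcal{U}$. For a family $\mathcal{U}$ of subsets of $X$ and $A\subseteq X$, the $\mathcal{U}$-components of $A$ are the equivalence classes of the relation on $A$: $x,x'$ are joined by a finite sequence $x=x_1,\dots,x_k=x'$ in $A$ with each pair $x_i,x_{i+1}$ in a common element of $\mathcal{U}$. For uniformly bounded $\mathcal{U}$ in $X$, $\mathcal{V}$ in $Y$, $c(\mathcal{U},f,\mathcal{V})$ is the family of all $\mathcal{U}$-components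 of sets $f^{-1}(V)$, $V\in\mathcal{V}$. The light structure on $X$ with respect to $f$ is the closure under refinement of the set of all $c(\mathcal{U},f,\mathcal{V})$ (all families each of whose elements with more than one point is contained in an element of one fixed $c(\mathcal{U},f,\mathcal{V})$). The map $f$ is coarsely light if the light structure with respect to $f$ equals the ls-structure of $X$. An ls-space $X$ has asymptotic dimension at most $n$ if for every uniformly bounded cover $\mathcal{U}$ of $X$ there is a uniformly bounded cover $\mathcal{V}$ of $X$ which $\mathcal{U}$ refines and which has point multiplicity at most $n+1$ (each point lies in at most $n+1$ elements of $\mathcal{V}$). The asymptotic dimension is the least such $n$, or $\infty$ if there is none. *)

(* Defs.v *)
From HB Require Import structures.
From mathcomp Require Import all_boot all_order all_algebra.
From mathcomp Require Import boolp classical_sets cardinality constructive_ereal.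
Set Implicit Arguments.
Unset Strict Implicit.
Unset Printing Implicit Defensive.

Local Open Scope classical_set_scope.
Local Open Scope card_scope.

Section families.
Context {X : Type}.
Implicit Types (A B : set X) (UU VV : set (set X)).

Definition st B UU : set X := \bigcup_(U in [set U | UU U /\ B `&` U !=set0]) U.

Definition st_family VV UU : set (set X) := [set st B UU | B in VV].

Definition is_cover UU : Prop := \bigcup_(U in UU) U = setT.

Definition refines UU VV : Prop :=
  forall U, UU U -> exists2 V, VV V & U `<=` V.

(* Only the elements with more than one point are constrained, so that any
   collection of singletons (and the empty set) refines every family. *)
Definition coarsely_refines UU VV : Prop :=
  forall U, UU U -> ~ is_subset1 U -> exists2 V, VV V & U `<=` V.

(* The chain s 0, ..., s k may be reduced to one point (k = 0), so the
   relation is reflexive on A even when UU does not cover A. *)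
Definition chained UU A (x x' : X) : Prop :=
  exists (k : nat) (s : nat -> X),
    [/\ s 0 = x, s k = x',
        forall i, i <= k -> A (s i)
      & forall i, i < k -> exists U, [/\ UU U, U (s i) & U (s i.+1)]].

Definition components UU A : set (set X) :=
  [set [set x' | chained UU A x x'] | x in A].

Definition multiplicity_le UU (m : nat) : Prop :=
  forall x, [set U | UU U /\ U x] #<= `I_m.

End families.

HB.mixin Record isLargeScale X := {
  uniformly_bounded : set (set (set X));
  uniformly_bounded_nonempty : uniformly_bounded !=set0;
  uniformly_bounded_refine : forall BB1 BB2 : set (set X),
    uniformly_bounded BB1 -> coarsely_refines BB2 BB1 -> uniformly_bounded BB2;
  uniformly_bounded_st : forall BB1 BB2 : set (set X),
    uniformly_bounded BB1 -> uniformly_bounded BB2 ->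
    uniformly_bounded (st_family BB1 BB2)
}.

#[short(type="lsType")]
HB.structure Definition LargeScale := {X of isLargeScale X}.

Definition ls_continuous (X Y : lsType) (f : X -> Y) : Prop :=
  forall UU : set (set X), uniformly_bounded UU ->
    uniformly_bounded [set f @` U | U in UU].

Definition component_family (X Y : Type) (UU : set (set X)) (f : X -> Y)
    (VV : set (set Y)) : set (set X) :=
  \bigcup_(V in VV) components UU (f @^-1` V).

Definition light_structure (X Y : lsType) (f : X -> Y) : set (set (set X)) :=
  [set WW | exists UU VV, [/\ uniformly_bounded UU, uniformly_bounded VV
                            & coarsely_refines WW (component_family UU f VV)]].

Definition coarsely_light (X Y : lsType) (f : X -> Y) : Prop :=
  light_structure f = uniformly_bounded.

Definition asdim_at_most (X : lsType) (n : nat) : Prop :=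
  forall UU : set (set X), uniformly_bounded UU -> is_cover UU ->
    exists VV : set (set X),
      [/\ uniformly_bounded VV, is_cover VV, refines UU VV
        & multiplicity_le VV n.+1].

(* \bar int is used only to have an ordered type containing the natural
   numbers and +oo; the value is always a natural number or +oo. *)
Definition asdim (X : lsType) : \bar int :=
  match pselect (exists n, `[< asdim_at_most X n >]) with
  | left ex_n => (Posz (ex_minn ex_n))%:E
  | right _ => +oo%E
  end.

(* Main.v *)
Require Import Defs.
From mathcomp Require Import all_boot all_order all_algebra.
From mathcomp Require Import boolp classical_sets cardinality constructive_ereal.
From mathcomp Require Import zify.

(** Given a uniformly bounded cover [UU] of [X], cover [Y] by a uniformly
    bounded family [VV] of small multiplicity which [f(UU)] refines, and pull it
    back to the [UU]-components of the sets [f^-1(V)].  Lightness makes these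
    components uniformly bounded.  Since a point [x] of [f^-1(V)] lies in exactly
    one [UU]-component of that set, [V |-> component of x] maps the members of
    [VV] containing [f x] onto the components containing [x], so the
    multiplicity does not increase. *)

Set Implicit Arguments.
Unset Strict Implicit.
Unset Printing Implicit Defensive.

Local Open Scope classical_set_scope.

Section chains.
Context {X : Type} (UU : set (set X)) (A : set X).

Lemma chained_refl x : A x -> chained UU A x x.
Proof. by move=> Ax; exists 0, (fun=> x). Qed.

Lemma chained_sym x y : chained UU A x y -> chained UU A y x.
Proof.
move=> [k [s [s0 sk sA sU]]]; exists k, (fun i => s (k - i)).
split; rewrite ?subn0 ?subnn//; first by move=> i _; apply/sA/leq_subr.
(* Link [i] of the reversed chain is link [k - i - 1] of the original. *)
move=> i ik; have [|U [UUU Us Us']] := sU (k - i.+1); first by lia.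
by exists U; split=> //; move: Us'; rewrite -subSn// subSS.
Qed.

Lemma chained_trans y x z :
  chained UU A x y -> chained UU A y z -> chained UU A x z.
Proof.
move=> [k [s [s0 sk sA sU]]] [l [t [t0 tl tA tU]]].
exists (k + l), (fun i => if i <= k then s i else t (i - k)); split=> //.
(* The concatenation ends in its first branch only when [t] has no links. *)
- case: ifPn => [kl|_]; last by rewrite addKn.
  have l0 : l = 0 by lia.
  by rewrite l0 addn0 sk -t0 -tl l0.
- by move=> i ikl; case: ifPn => ik; [exact: sA|apply: tA; lia].
- move=> i ikl; case: (ltngtP i k) => ik.
  + exact: sU.
  + by rewrite subSn; [apply: tU; lia|exact: ltnW].
  + by rewrite ik sk subSnn -t0; apply: tU; lia.
Qed.

Lemma chained_endr x y : chained UU A x y -> A y.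
Proof. by move=> [k [s [_ <- sA _]]]; exact: sA. Qed.

Lemma chained_in U x y : UU U -> U `<=` A -> U x -> U y -> chained UU A x y.
Proof.
move=> UUU UA Ux Uy; exists 1, (fun i => if i is 0 then x else y).
split=> // [[|i] _|[|//] _]; [exact: UA|exact: UA|by exists U].
Qed.

Lemma component_eq x y : chained UU A x y ->
  [set z | chained UU A x z] = [set z | chained UU A y z].
Proof.
move=> xy; apply/seteqP; split=> z /=; last exact: chained_trans.
by apply: chained_trans; exact: chained_sym.
Qed.

End chains.

Section component_family.
Context {X Y : Type} (UU : set (set X)) (f : X -> Y) (VV : set (set Y)).

Lemma component_family_cover : is_cover VV ->
  is_cover (component_family UU f VV).
Proof.
move=> VVT; apply/seteqP; split=> // x _.
have [V VVV Vfx] : (\bigcup_(V in VV) V) (f x) by rewrite VVT.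
exists [set x' | chained UU (f @^-1` V) x x']; last exact: chained_refl.
by exists V => //; exists x.
Qed.

Lemma component_family_multiplicity m : multiplicity_le VV m ->
  multiplicity_le (component_family UU f VV) m.
Proof.
move=> VVm x; apply: card_le_trans (VVm (f x)).
pose comp V := [set x' | chained UU (f @^-1` V) x x'].
apply: card_le_trans (card_image_le comp _).
apply: subset_card_le => W [[V VVV [y _ <-]] /= yx].
exists V; first by split=> //; exact: (chained_endr yx).
(* [W] is given as the component of [y]; since it contains [x], it is also that of [x]. *)
exact/esym/component_eq.
Qed.

(* [set0] is needed for [X] empty: then [UU] may contain [set0], whereas there
   are no components. *)
Lemma refines_component_family : refines [set f @` U | U in UU] VV ->
  refines UU (set0 |` component_family UU f VV).
Proof.
move=> fUV U UUU; have [->|/set0P[x Ux]] := eqVneq U set0.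
  by exists set0; [left|].
have [|V VVV fUsubV] := fUV (f @` U); first by exists U.
have UV : U `<=` f @^-1` V by move=> y Uy; apply: fUsubV; exists y.
exists [set x' | chained UU (f @^-1` V) x x'].
  by right; exists V => //; exists x => //; exact: UV.
by move=> y Uy; exact: (chained_in UUU).
Qed.

End component_family.

(** Coarse refinement ignores sets with at most one point. This allows adding singletons to obtain a
    cover, and adding [set0]. *)
Lemma uniformly_bounded_add_subset1 (X : lsType) (UU SS : set (set X)) :
    uniformly_bounded UU -> (forall S, SS S -> is_subset1 S) ->
  uniformly_bounded (SS `|` UU).
Proof.
move=> UUb SS1; apply: uniformly_bounded_refine UUb _ => U [/SS1//|UUU _].
by exists U.
Qed.

Lemma asdim_at_most_light (X Y : lsType) (f : X -> Y) n :
  ls_continuous f -> coarsely_light f -> asdim_at_most Y n -> asdim_at_most X n.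
Proof.
move=> fc fl Yn UU UUb UUT.
(* As [f] may fail to be surjective, the singletons of [Y] are added to make the images of [UU] a
   cover. *)
have [||VV [VVb VVT fUV VVm]] := Yn (range set1 `|` [set f @` U | U in UU]).
- apply: uniformly_bounded_add_subset1 (fc _ UUb) _ => _ [y _ <-].
  by move=> a b /= -> ->.
- apply/seteqP; split=> // y _.
  by exists [set y] => //; left; exists y.
exists (set0 |` component_family UU f VV); split.
- apply: uniformly_bounded_add_subset1 => [|_ -> ? ? []//].
  (* The component family refines itself, so it lies in the light structure. *)
  rewrite -fl; exists UU, VV; split=> // W WW _; by exists W.
- apply/seteqP; split=> // x _.
  have [W WW Wx] : (\bigcup_(W in component_family UU f VV) W) x.
    by rewrite component_family_cover.
  by exists W => //; right.
- by apply: refines_component_family => U UUU; apply: fUV; right.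
- move=> x.
  apply: card_le_trans (component_family_multiplicity UU f VVm x).
  (* [set0] contains no point, so it does not affect the multiplicity. *)
  by apply: subset_card_le => W [[->//|WW] Wx].
Qed.

(** The least bound for [Y], if any, is also a bound for [X], hence at least the least one for [X];
    otherwise the right-hand side is infinite. *)
Lemma le_asdim (X Y : lsType) :
  (forall n, asdim_at_most Y n -> asdim_at_most X n) -> (asdim X <= asdim Y)%E.
Proof.
move=> YX; rewrite /asdim; case: (pselect (exists n, `[< asdim_at_most Y n >])).
  move=> exY; case: pselect => [exX|[]].
    rewrite lee_fin lez_nat; case: (ex_minnP exY) => n /asboolP/YX Xn _.
    by case: ex_minnP => m _; apply; exact/asboolP.
  by case: exY => n /asboolP/YX Xn; exists n; exact/asboolP.
by move=> _; exact: leey.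
Qed.

Theorem proposition9p1 (X Y : lsType) (f : X -> Y)
    (f_continuous : ls_continuous f) (f_light : coarsely_light f) :
  (asdim X <= asdim Y)%E.
Proof. by apply: le_asdim => n; exact: (asdim_at_most_light f_continuous f_light). Qed.
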